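(* The following are equivalent for a Prüfer domain $R$. (1) $R$ is $h$-local. (2) $R$ has the strong factorization property. (3) For each nonzero ideal $I$ of $R$, $I$ is divisorial if and only if $IR_M$ is divisorial in $R_M$ for each maximal ideal $M$ of $R$. (4) For each nonzero ideal $I$ of $R$, if $IR_M$ is divisorial in $R_M$ for each maximal ideal $M$ of $R$, then $I$ is divisorial.
   Context: For an integral domain $D$ with quotient field $K$ and a nonzero fractional ideal $F$ of $D$, put $F^{-1} = (D:F) = \{x \in K \mid xF \subseteq D\}$ and $F^v = (F^{-1})^{-1}$. A nonzero ideal $F$ is divisorial if $F = F^v$; divisoriality of an ideal of $R_M$ is understood with respect to the domain $R_M$. An integral domain $R$ has finite character if each nonzero element of $R$ is contained in only finitely many maximal ideals, and $R$ is $h$-local if it has finite character and each nonzero prime ideal of $R$ is contained in a unique maximal ideal of $R$. A Prüfer domain $R$ has the strong factorization property if for each nonzero ideal $I$ of $R$: (a) $I = I^v M_1 \cdots M_n$, where $M_1,\ldots,M_n$ are precisely the nondivisorial maximal ideals $M$ of $R$ which contain $I$ and for which $IR_M$ is nondivisorial in $R_M$ (in particular there are only finitely many of these), and (b) this factorization is unique in the sense that no $M_i$ can be omitted. The empty product of maximal ideals is taken to be $R$. *)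

(* Defs.v *)
From mathcomp Require Import all_boot all_order all_algebra.
From mathcomp Require Import boolp classical_sets cardinality.

Set Implicit Arguments.
Unset Strict Implicit.
Unset Printing Implicit Defensive.

Import GRing.Theory.
Local Open Scope classical_set_scope.
Local Open Scope ring_scope.

(* Fractional ideals of a domain D with quotient field K, where D, its ideals
   and its overrings are all subsets of K; this treats R and the localizations
   R_M (which share the quotient field K) uniformly. *)
Section FractionalIdeals.
Variable K : fieldType.
Implicit Types D F G : set K.

(* The module product FG: finite sums of products. *)
Definition fmul F G : set K :=
  [set x | exists n (f g : 'I_n -> K),
     [/\ forall i, F (f i), forall i, G (g i) & x = \sum_(i < n) f i * g i]].

(* (D : F) *)
Definition finv D F : set K := [set x | forall y, F y -> D (x * y)].

Definition vclosure D F : set K := finv D (finv D F).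

Definition divisorial D F : Prop := F = vclosure D F.

Definition invertible D F : Prop := fmul F (finv D F) = D.

End FractionalIdeals.

Section Ideals.
Variable R : idomainType.
Implicit Types I M P : set R.

(* Ideals may be improper; [idealr_closed] below includes properness. *)
Definition ideal I : Prop := submod_closed (mem I : {pred R^o}).

Definition nonzero_ideal I : Prop := ideal I /\ I <> [set 0].

Definition prime_ideal P : Prop :=
  idealr_closed (mem P : {pred R}) /\ prime_idealr_closed (mem P : {pred R}).

(* The zero ideal of a field is maximal. *)
Definition maximal_ideal M : Prop :=
  idealr_closed (mem M : {pred R}) /\
  forall J : set R, idealr_closed (mem J : {pred R}) -> M `<=` J -> J = M.

Definition finitely_generated I : Prop :=
  exists n (a : 'I_n -> R),
    I = [set x | exists c : 'I_n -> R, x = \sum_(i < n) c i * a i].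

Definition emb I : set {fraction R} := [set tofrac x | x in I].

(* R viewed as a subring of its quotient field. *)
Definition base : set {fraction R} := emb setT.

(* R_M; only meaningful when the complement of M is multiplicative. *)
Definition loc M : set {fraction R} :=
  [set x | exists a s : R, ~ M s /\ x = tofrac a / tofrac s].

(* I R_M *)
Definition ext I M : set {fraction R} := fmul (emb I) (loc M).

End Ideals.
Arguments base : clear implicits.

Definition prufer (R : idomainType) : Prop :=
  forall I : set R, nonzero_ideal I -> finitely_generated I ->
    invertible (base R) (emb I).

Definition finite_character (R : idomainType) : Prop :=
  forall x : R, x <> 0 -> finite_set [set M : set R | maximal_ideal M /\ M x].

Definition h_local (R : idomainType) : Prop :=
  finite_character R /\
  forall P : set R, prime_ideal P -> P <> [set 0] ->
    exists! M : set R, maximal_ideal M /\ P `<=` M.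

(* The maximal ideals that appear in the strong factorization of I. *)
Definition factor_set (R : idomainType) (I : set R) : set (set R) :=
  [set M | [/\ maximal_ideal M, ~ divisorial (base R) (emb M),
               I `<=` M & ~ divisorial (loc M) (ext I M)]].

(* Injectivity makes the M i pairwise distinct; the empty product of ideals
   is R. *)
Definition strong_factorization (R : idomainType) : Prop :=
  forall I : set R, nonzero_ideal I ->
    exists n (M : 'I_n -> set R),
      [/\ injective M,
          factor_set I = range M,
          emb I = fmul (vclosure (base R) (emb I))
                        (\big[@fmul _/base R]_(i < n) emb (M i)) &
          forall k : 'I_n,
            emb I <> fmul (vclosure (base R) (emb I))
                           (\big[@fmul _/base R]_(i < n | i != k) emb (M i))].

(* Main.v *)
Require Import Defs.
From mathcomp Require Import all_boot all_order all_algebra.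
From mathcomp Require Import boolp classical_sets cardinality.
From mathcomp Require Import ring.

(** For maximal M the localization R_M of a Prüfer domain is a valuation ring V
    with maximal ideal m, and an ideal J of V fails to be divisorial only when
    J = y m with y in the divisorial closure J^v and not in J; then J^v = y V
    ([valuation_nondivisorialE], [valuation_nondivisorial_vclosureE]).  If some
    I R_M is of this form then M^{-1} = R, so M itself is not divisorial
    ([nondivisorial_ext_maximal]).  Hence the maximal ideals that should occur
    in the factorization of I are exactly those with I R_M nondivisorial.

    h-local implies strong factorization.  Two maximal ideals M <> N that share
    no nonzero prime are independent: R_M R_N = K, or elementwise, each q <> 0
    divides some s t with s outside M and t outside N
    ([h_local_independent]).  With finite character this makes inverses, and
    then divisorial closures, commute with localization ([local_inverse],
    [vclosure_ext], [ext_vclosure]).  So I = I^v M_1 ... M_n can be checked at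
    each maximal ideal, where it reads J = J^v or y m = (y V) m; and without
    M_k the right-hand side becomes J^v at M_k, which is not J.

    Strong factorization implies the local criterion for divisoriality: if I is
    divisorial, dropping a factor M_k from I = I^v M_1 ... M_n leaves a
    module between I and I^v = I, so the omission clause forbids any factor;
    and without factors I = I^v.

    The local criterion implies h-local.  For N maximal and x <> 0 the ideal
    R \cap x R_N localizes at M to R_M \cap x R_M R_N, which is divisorial
    since R_M R_N is a valuation overring of R_M; so R \cap x R_N is divisorial
    ([contraction_divisorial]).  If R_M R_N were not K for some M <> N, take x
    in its maximal ideal and s in N but not in M: the element t x / s, for some
    t outside N that puts it in R, lies in the divisorial closure of
    R \cap x R_N but not in x R_N.  So distinct maximal ideals are
    independent.  For finite character at x, the elements b such that b / x lies
    in R_M for all but finitely many maximal M containing x form an ideal.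
    Were this ideal inside a maximal M, every z with z / x in all R_N, N <> M,
    would be in M, and then x would lie in the divisorial closure
    of R \cap x^2 R_M, hence in x^2 R_M, which is absurd as x is in M.  So 1 is
    in the ideal, and only finitely many M contain x. *)

Set Implicit Arguments.
Unset Strict Implicit.
Unset Printing Implicit Defensive.

Import GRing.Theory.
Local Open Scope classical_set_scope.
Local Open Scope ring_scope.

(* [finv] alone would denote the inverse of an injection of a finite type. *)
Local Notation finv := Defs.finv.
Local Notation "x %:F" := (tofrac x).

(** * Divisorial modules over a valuation ring *)

Section Divisoriality.
Variable K : fieldType.
Implicit Types D F J T V W : set K.

Definition smul_closed D F := forall d f, D d -> F f -> F (d * f).

Lemma fmul_in F G f g : F f -> G g -> fmul F G (f * g).
Proof.
move=> Ff Gg; exists 1%N, (fun=> f), (fun=> g).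
by split=> //; rewrite big_ord1.
Qed.

Lemma fmul_add F G x y : fmul F G x -> fmul F G y -> fmul F G (x + y).
Proof.
move=> [m [f [g [Ff Gg ->]]]] [n [f' [g' [Ff' Gg' ->]]]].
exists (m + n)%N, (fun i => match split i with inl j => f j | inr j => f' j end),
  (fun i => match split i with inl j => g j | inr j => g' j end).
split=> [i|i|]; try by case: (split i).
rewrite big_split_ord /=; congr (_ + _); apply: eq_bigr => i _.
  by rewrite (unsplitK (inl i)).
by rewrite (unsplitK (inr i)).
Qed.

Lemma fmul_ind F G H : H 0 -> (forall x y, H x -> H y -> H (x + y)) ->
  (forall f g, F f -> G g -> H (f * g)) -> fmul F G `<=` H.
Proof.
move=> H0 HD HM _ [n [f [g [Ff Gg ->]]]].
by apply: (big_ind H) => // i _; apply: HM.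
Qed.

Lemma fmul0 F G : fmul F G 0.
Proof. by exists 0%N, (fun=> 0), (fun=> 0); split=> [[]|[]|] //; rewrite big_ord0. Qed.

Lemma fmul_smul D F G : smul_closed D F -> smul_closed D (fmul F G).
Proof.
move=> DF d _ Dd [n [f [g [Ff Gg ->]]]].
exists n, (fun i => d * f i), g; split=> // [i|]; first exact: DF.
by rewrite mulr_sumr; apply: eq_bigr => i _; rewrite mulrA.
Qed.

Lemma subset_vclosure D F : F `<=` vclosure D F.
Proof. by move=> f Ff x xF; rewrite mulrC; apply: xF. Qed.

Lemma divisorialP D F : divisorial D F <-> vclosure D F `<=` F.
Proof.
split=> [dF|vF]; first by rewrite -dF.
by apply/seteqP; split=> //; apply: subset_vclosure.
Qed.

Lemma not_divisorialP D F :
  ~ divisorial D F -> exists2 y, vclosure D F y & ~ F y.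
Proof.
move=> ndF; apply: contrapT => nex; apply: ndF; apply/divisorialP => y vy.
by apply: contrapT => nFy; apply: nex; exists y.
Qed.

(** A valuation ring, by its multiplicative properties: closure under product and
    totality already make its submodules a chain, which is what the description
    of nondivisorial modules rests on. *)
Record valuation V : Prop := Valuation {
  valuation1 : V 1;
  valuationM : smul_closed V V;
  valuation_total : forall x, V x \/ V x^-1 }.

Lemma valuation0 V : valuation V -> V 0.
Proof. by move=> vV; have [] := valuation_total vV 0; rewrite ?invr0. Qed.

Lemma valuation_chain V F G : valuation V -> smul_closed V F ->
  smul_closed V G -> F `<=` G \/ G `<=` F.
Proof.
move=> vV VF VG; have [FG|nFG] := pselect (F `<=` G); first by left.
right=> g Gg; apply: contrapT => nFg; apply: nFG => f Ff; apply: contrapT => nGf.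
have F0 : F 0 by rewrite -(mul0r f); apply: VF => //; apply: valuation0.
have G0 : G 0 by rewrite -(mul0r g); apply: VG => //; apply: valuation0.
have f0 : f != 0 by apply: contra_notN nGf => /eqP ->.
have g0 : g != 0 by apply: contra_notN nFg => /eqP ->.
have [/VG/(_ Gg)|] := valuation_total vV (f / g); first by rewrite divfK.
by rewrite invf_div => /VF/(_ Ff); rewrite divfK.
Qed.

(** Writing m for the maximal ideal of V, this says J = y m.  Every j in J
    satisfies y / j outside V, since otherwise y would be a multiple of j.
    Conversely, if z is not in J then J is contained in z V by totality, so
    1 / z is in J^{-1} and y in J^v gives y / z in V. *)
Lemma valuation_nondivisorialE V J y : valuation V -> smul_closed V J ->
  J 0 -> vclosure V J y -> ~ J y -> forall z, J z <-> z = 0 \/ ~ V (y / z).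
Proof.
move=> vV VJ J0 vy nJy z; split=> [Jz|[->//|nVz]].
  have [->|z0] := eqVneq z 0; [by left|right=> Vz].
  by apply: nJy; rewrite -[y](divfK z0); apply: VJ.
apply: contrapT => nJz; apply: nVz; apply: vy => j Jj.
have [|] := valuation_total vV (j / z); first by rewrite mulrC.
rewrite invf_div => Vzj; have [->|j0] := eqVneq j 0.
  by rewrite mulr0; apply: valuation0.
by case: nJz; rewrite -[z](divfK j0); apply: VJ.
Qed.

(** J^v = y V: from J = y m, the element 1 / y is in J^{-1}. *)
Lemma valuation_nondivisorial_vclosureE V J y : valuation V ->
  smul_closed V J -> J 0 -> vclosure V J y -> ~ J y ->
  forall z, vclosure V J z <-> V (z / y).
Proof.
move=> vV VJ J0 vy nJy z.
have y0 : y != 0 by apply: contra_notN nJy => /eqP ->.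
split=> [vz|Vzy w wJ].
  apply: vz => j /(valuation_nondivisorialE vV VJ J0 vy nJy) [->|nVyj].
    by rewrite mulr0; apply: valuation0.
  by have [|//] := valuation_total vV (j / y); rewrite ?invf_div // mulrC.
have -> : z * w = z / y * (y * w) by rewrite mulrA divfK.
by apply: valuationM => //; apply: vy.
Qed.

(** This set of products is the ring generated by V and W as soon as one of them
    is a valuation ring. *)
Definition compositum V W := [set a | exists v w, [/\ V v, W w & a = v * w]].

Lemma compositum_left V W : W 1 -> V `<=` compositum V W.
Proof. by move=> W1 v Vv; exists v, 1; rewrite mulr1. Qed.

Lemma compositum_right V W : V 1 -> W `<=` compositum V W.
Proof. by move=> V1 w Ww; exists 1, w; rewrite mul1r. Qed.

Lemma compositum_valuation V W :
  valuation V -> valuation W -> valuation (compositum V W).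
Proof.
move=> vV vW; split.
- by apply: compositum_left; [apply: valuation1|apply: valuation1].
- move=> _ _ [v [w [Vv Ww ->]]] [v' [w' [Vv' Ww' ->]]].
  by exists (v * v'), (w * w'); split; [exact: valuationM|exact: valuationM|rewrite mulrACA].
- have V1 := valuation1 vW.
  by move=> x; have [] := valuation_total vV x => ?; [left|right]; apply: compositum_left.
Qed.

Lemma compositum_smul_right V W : valuation W -> smul_closed W (compositum V W).
Proof.
move=> vW w _ Ww [v [w' [Vv Ww' ->]]].
by exists v, (w * w'); split; [|exact: valuationM|rewrite mulrCA].
Qed.

(** The maximal ideal of an overring T of a valuation ring V lies in V. *)
Lemma nonunit_overring V T x : valuation V -> V `<=` T -> ~ T x^-1 -> V x.
Proof. by move=> vV VT nTx; have [//|/VT] := valuation_total vV x. Qed.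

End Divisoriality.

(** * Maximal ideals *)

Section MaximalIdeals.
Variable R : idomainType.
Implicit Types I M N : set R.

Lemma idealP I : ideal I <->
  I 0 /\ forall a u v, I u -> I v -> I (a * u + v).
Proof.
split=> [[I0 Il]|[I0 Il]]; split=> [|a u v].
- exact/set_mem.
- by move=> Iu Iv; apply/set_mem/Il; apply/mem_set.
- exact/mem_set.
- by move=> /set_mem Iu /set_mem Iv; apply/mem_set/Il.
Qed.

Lemma proper_idealP I :
  idealr_closed (mem I : {pred R}) <-> ideal I /\ ~ I 1.
Proof.
split=> [[I0 I1 Il]|[/idealP[I0 Il] I1]].
  split; last by move/mem_set; apply/negP.
  apply/idealP; split=> [|a u v Iu Iv]; first exact/set_mem.
  by apply/set_mem/Il; apply/mem_set.
split; [exact/mem_set|by apply/negP => /set_mem|].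
by move=> a u v /set_mem Iu /set_mem Iv; apply/mem_set/Il.
Qed.

Lemma ideal0 I : ideal I -> I 0. Proof. by case/idealP. Qed.

Lemma idealD I u v : ideal I -> I u -> I v -> I (u + v).
Proof. by case/idealP=> _ Il Iu Iv; rewrite -[u]mul1r; apply: Il. Qed.

Lemma idealM I a u : ideal I -> I u -> I (a * u).
Proof. by case/idealP=> I0 Il Iu; rewrite -[_ * _]addr0; apply: Il. Qed.

Lemma maximal_ideal_ideal M : maximal_ideal M -> ideal M.
Proof. by case=> /proper_idealP[]. Qed.

Lemma maximal_ideal_proper M : maximal_ideal M -> ~ M 1.
Proof. by case=> /proper_idealP[]. Qed.

(** Maximal ideals are prime, in the form used throughout: the complement of M
    is multiplicative, so that R_M is a ring. *)
Lemma maximal_ideal_mul M a b : maximal_ideal M -> ~ M a -> ~ M b -> ~ M (a * b).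
Proof.
move=> mM nMa nMb Mab; have idM := maximal_ideal_ideal mM.
pose J : set R := [set x | exists m c, M m /\ x = m + c * a].
have idJ : ideal J.
  apply/idealP; split=> [|r _ _ [m [c [Mm ->]]] [m' [c' [Mm' ->]]]].
    by exists 0, 0; rewrite mul0r addr0; split=> //; apply: ideal0.
  exists (r * m + m'), (r * c + c'); split; last by ring.
  by apply: idealD => //; apply: idealM.
have [[m [c [Mm e]]]|nJ1] := pselect (J 1).
  apply: nMb; rewrite -[b]mul1r e mulrDl -mulrA mulrC.
  by apply: idealD => //; apply: idealM.
apply: nMa; case: mM => _ mM; rewrite -(mM J).
- by exists 0, 1; rewrite mul1r add0r; split=> //; apply: ideal0.
- exact/proper_idealP.
- by move=> m Mm; exists m, 0; rewrite mul0r addr0.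
Qed.

Lemma maximal_ideal_neq M N : maximal_ideal M -> maximal_ideal N -> M <> N ->
  exists2 s, N s & ~ M s.
Proof.
move=> mM mN neMN; apply: contrapT => nex; apply: neMN.
case: mN => _; apply; first by case: mM.
by move=> s Ns; apply: contrapT => nMs; apply: nex; exists s.
Qed.

Lemma exists_maximal_ideal I : ideal I -> ~ I 1 ->
  exists2 M, maximal_ideal M & I `<=` M.
Proof.
move=> idI nI1.
pose P := [set J : set R | J = set0 \/ [/\ ideal J, ~ J 1 & I `<=` J]].
(* The empty set is admitted because it is the union of the empty chain. *)
have [F FP totF|M [PM maxM]] := @Zorn_bigcup _ P.
  have [[J FJ J0]|noJ] := pselect (exists2 J, F J & J !=set0); last first.
    left; apply/seteqP; split=> // x [J FJ Jx]; case: noJ.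
    by exists J => //; exists x.
  have FP' A x : F A -> A x -> [/\ ideal A, ~ A 1 & I `<=` A].
    by move=> FA Ax; have [A0|//] := FP _ FA; rewrite A0 in Ax.
  right; case: J0 => j Jj; split.
  - apply/idealP; split.
      by exists J => //; apply: ideal0; have [] := FP' _ _ FJ Jj.
    move=> a u v [A FA Au] [B FB Bv].
    have [idA _ _] := FP' _ _ FA Au; have [idB _ _] := FP' _ _ FB Bv.
    have [AB|BA] := totF _ _ FA FB.
      by exists B => //; apply: idealD => //; apply: idealM => //; apply: AB.
    by exists A => //; apply: idealD => //; [apply: idealM|apply: BA].
  - by move=> [A FA A1]; have [] := FP' _ _ FA A1.
  - by move=> x Ix; exists J => //; have [_ _] := FP' _ _ FJ Jj; apply.
have {PM} [idM nM1 IM] : [/\ ideal M, ~ M 1 & I `<=` M].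
  case: PM => // M0; case: (maxM I); last by right; split.
  rewrite M0; split; first exact: sub0set.
  by move=> /(_ 0 (ideal0 idI)).
exists M => //; split=> [|J /proper_idealP[idJ nJ1] MJ]; first exact/proper_idealP.
apply: contrapT => neJM; apply: (maxM J).
  split=> // JM; apply: neJM; exact/seteqP.
by right; split=> //; apply: subset_trans MJ.
Qed.

End MaximalIdeals.

(** * Localizations inside the quotient field *)

Section Localization.
Variable R : idomainType.
Implicit Types I M N : set R.

Lemma tofrac_neq0 (x : R) : x <> 0 -> x%:F != 0.
Proof. by move=> x0; rewrite tofrac_eq0; apply/eqP. Qed.

Lemma fractionP (z : {fraction R}) : exists a s, s <> 0 /\ z = a%:F / s%:F.
Proof.
elim/quotW: z => x; exists \n_x, \d_x; split; first exact/eqP/denom_ratioP.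
have d0 := denom_ratioP x; unlock FracField.tofrac.
rewrite -[X in _ * X]FracField.pi_inv -[RHS]FracField.pi_mul.
rewrite /FracField.mulf /FracField.invf /= !numden_Ratio ?oner_neq0 //.
by rewrite mulr1 mul1r Ratio_numden.
Qed.

Variable M : set R.
Hypothesis mM : maximal_ideal M.

Lemma maximal_ideal_notin0 s : ~ M s -> s%:F != 0.
Proof.
move=> nMs; apply: tofrac_neq0; apply: contra_not nMs => ->.
exact: (ideal0 (maximal_ideal_ideal mM)).
Qed.

Lemma base_loc : base R `<=` loc M.
Proof.
move=> _ [a _ <-]; exists a, 1; rewrite tofrac1 divr1; split=> //.
exact: maximal_ideal_proper.
Qed.

Lemma tofrac_loc a : loc M a%:F. Proof. by apply: base_loc; exists a. Qed.

Lemma inv_loc s : ~ M s -> loc M s%:F^-1.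
Proof. by move=> Ms; exists 1, s; rewrite tofrac1 mul1r. Qed.

Lemma loc_mul : smul_closed (loc M) (loc M).
Proof.
move=> _ _ [a [s [Ms ->]]] [b [t [Mt ->]]]; exists (a * b), (s * t).
split; first exact: maximal_ideal_mul.
by rewrite !tofracM invfM mulrACA.
Qed.

Lemma inv_loc_notin s : loc M s%:F^-1 -> s <> 0 -> ~ M s.
Proof.
move=> [a [t [Mt e]]] s0 Ms; apply: (Mt).
suff -> : t = a * s by apply: idealM => //; apply: maximal_ideal_ideal.
apply/eqP; rewrite -tofrac_eq tofracM; apply/eqP.
have := maximal_ideal_notin0 Mt; have := tofrac_neq0 s0.
by move=> s0' t0; rewrite -[a%:F](divfK t0) -e mulrAC mulVf ?mul1r.
Qed.

Lemma extP I z : ideal I ->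
  ext I M z <-> exists a s, [/\ I a, ~ M s & z = a%:F / s%:F].
Proof.
move=> idI; split=> [|[a [s [Ia Ms ->]]]]; last first.
  by apply: fmul_in; [exists a|apply: inv_loc].
apply: (@fmul_ind _ _ _ [set z | _]) => /=.
- by exists 0, 1; split; rewrite ?tofrac0 ?mul0r;
    [apply: ideal0|apply: maximal_ideal_proper|].
- move=> _ _ [a [s [Ia Ms ->]]] [b [t [Ib Mt ->]]].
  exists (t * a + s * b), (s * t); split; first by apply: idealD => //; apply: idealM.
    exact: maximal_ideal_mul.
  rewrite tofracD !tofracM addf_div ?maximal_ideal_notin0 //.
  by rewrite [a%:F * _]mulrC [b%:F * _]mulrC.
- move=> _ _ [a Ia <-] [b [s [Ms ->]]]; exists (b * a), s; split; [exact: idealM|exact: Ms|].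
  by rewrite tofracM mulrCA mulrA.
Qed.

Lemma ext_smul I : ideal I -> smul_closed (loc M) (ext I M).
Proof.
move=> idI u z Lu /(extP _ idI)[a [s [Ia Ms ->]]]; apply/extP => //.
case: Lu => [b [t [Mt ->]]]; exists (b * a), (t * s); split.
- exact: idealM.
- exact: maximal_ideal_mul.
- by rewrite !tofracM invfM mulrACA.
Qed.
End Localization.

(** * From local to global *)

Section BaseRing.
Variable R : idomainType.
Implicit Types I M N : set R.

Lemma base1 : base R 1. Proof. by exists 1; rewrite ?tofrac1. Qed.
Lemma base0 : base R 0. Proof. by exists 0; rewrite ?tofrac0. Qed.

Lemma baseD x y : base R x -> base R y -> base R (x + y).
Proof. by move=> [a _ <-] [b _ <-]; exists (a + b); rewrite ?tofracD. Qed.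

Lemma baseM : smul_closed (base R) (base R).
Proof. by move=> _ _ [a _ <-] [b _ <-]; exists (a * b); rewrite ?tofracM. Qed.

Lemma emb_base I : emb I `<=` base R.
Proof. by move=> _ [a _ <-]; exists a. Qed.

Lemma embP I a : emb I a%:F <-> I a.
Proof.
split=> [[b Ib /eqP]|Ia]; last by exists a.
by rewrite tofrac_eq => /eqP <-.
Qed.

Lemma emb_smul (I : set R) : ideal I -> smul_closed (base R) (emb I).
Proof.
move=> idI _ _ [a _ <-] [b Ib <-].
by exists (a * b); [apply: idealM|rewrite tofracM].
Qed.

Lemma emb0 (I : set R) : ideal I -> emb I 0.
Proof. by move=> idI; exists 0; [apply: ideal0|rewrite tofrac0]. Qed.

Lemma emb_add (I : set R) x y : ideal I -> emb I x -> emb I y -> emb I (x + y).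
Proof.
by move=> idI [a Ia <-] [b Ib <-]; exists (a + b); [apply: idealD|rewrite tofracD].
Qed.

Lemma emb_smulr (I : set R) x y : ideal I -> emb I x -> base R y -> emb I (x * y).
Proof. by move=> idI Ix Ry; rewrite mulrC; apply: emb_smul. Qed.

Lemma fmul_emb_sub (I : set R) F : ideal I -> F `<=` base R ->
  fmul (emb I) F `<=` emb I.
Proof.
move=> idI FR; apply: fmul_ind => [|x y|x y Ix Fy].
- exact: emb0.
- exact: emb_add.
- by apply: emb_smulr => //; apply: FR.
Qed.

(** The elements s of R with s x in G form an ideal, so if no maximal ideal
    contains all of them then 1 is one of them.  This is the principle by
    which every equality of modules below is checked locally. *)
Lemma local_to_global (G : set {fraction R}) x :
  G 0 -> (forall u v, G u -> G v -> G (u + v)) -> smul_closed (base R) G ->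
  (forall M, maximal_ideal M -> exists2 s, ~ M s & G (s%:F * x)) -> G x.
Proof.
move=> G0 GD GM Gloc; apply: contrapT => nGx.
pose J : set R := [set s | G (s%:F * x)].
have [] := @exists_maximal_ideal R J.
- apply/idealP; rewrite /J; split=> /= [|a u v Gu Gv]; first by rewrite tofrac0 mul0r.
  rewrite tofracD tofracM mulrDl -mulrA; apply: GD => //; apply: GM => //.
  by exists a.
- by rewrite /J /= tofrac1 mul1r.
- by move=> M mM JM; have [s nMs Gs] := Gloc M mM; apply/nMs/JM.
Qed.

Lemma base_local x :
  (forall M, maximal_ideal M -> loc M x) -> base R x.
Proof.
move=> Lx; apply: local_to_global base0 baseD baseM _ => M mM.
have [a [s [nMs ->]]] := Lx M mM; exists s => //.
by exists a => //; rewrite mulrC divfK // (maximal_ideal_notin0 mM).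
Qed.

Lemma emb_local I x : ideal I ->
  (forall M, maximal_ideal M -> ext I M x) -> emb I x.
Proof.
move=> idI Ix; apply: local_to_global => [|u v|u v|M mM].
- exact: emb0.
- exact: emb_add.
- exact: emb_smul.
have [a [s [Ia nMs ->]]] := (extP mM _ idI).1 (Ix M mM); exists s => //.
by exists a => //; rewrite mulrC divfK // (maximal_ideal_notin0 mM).
Qed.

Lemma finv_emb_ext I M z : maximal_ideal M -> ideal I ->
  finv (base R) (emb I) z -> finv (loc M) (ext I M) z.
Proof.
move=> mM idI zI _ /(extP mM _ idI) [a [s [Ia nMs ->]]]; rewrite mulrA.
apply: (loc_mul mM); last exact: inv_loc.
by apply/base_loc/zI => //; exists a.
Qed.

(** For x = a / s, invertibility of the ideal (a, s) gives u, v in its inverse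
    with 1 = a u + s v.  As M is proper, a u or s v lies outside M; in the
    first case s / a = (s u) / (a u) is in R_M, in the second a / s is. *)
Lemma prufer_valuation M : prufer R -> maximal_ideal M -> valuation (loc M).
Proof.
move=> hR mM; split; [exact/(base_loc mM)/base1|exact: loc_mul|].
move=> x; have [a [s [s0 ->]]] := fractionP x.
have [->|a0] := eqVneq a 0.
  by left; rewrite tofrac0 mul0r -tofrac0; apply: tofrac_loc.
pose g (i : 'I_2) := if i == 0 then a else s.
pose I := [set x | exists c : 'I_2 -> R, x = \sum_(i < 2) c i * g i].
have IP u : I u <-> exists c d, u = c * a + d * s.
  split=> [[c ->]|[c [d ->]]].
    by exists (c ord0), (c (lift ord0 ord0)); rewrite !big_ord_recl big_ord0 addr0.
  exists (fun i => if i == 0 then c else d).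
  by rewrite !big_ord_recl big_ord0 addr0.
have Ia : I a by apply/IP; exists 1, 0; ring.
have Is : I s by apply/IP; exists 0, 1; ring.
have /hR invI : nonzero_ideal I.
  split; last by move=> I0; move: Is; rewrite I0.
  apply/idealP; split; first by apply/IP; exists 0, 0; ring.
  move=> r u v /IP[c [d ->]] /IP[c' [d' ->]]; apply/IP.
  by exists (r * c + c'), (r * d + d'); ring.
have {}invI : invertible (base R) (emb I) by apply: invI; exists 2%N, g.
pose Iv := finv (base R) (emb I).
have IvD u v : Iv u -> Iv v -> Iv (u + v).
  by move=> Iu Iv' y Iy; rewrite mulrDl; apply: baseD; [apply: Iu|apply: Iv'].
have IvM : smul_closed (base R) Iv.
  by move=> r u Br Iu y Iy; rewrite -mulrA; apply: baseM => //; apply: Iu.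
have [u [v [Iu Iv' e]]] : exists u v, [/\ Iv u, Iv v & 1 = a%:F * u + s%:F * v].
  have := base1; rewrite -invI; move: 1.
  apply: (@fmul_ind _ _ _ [set z | _]) => /=.
  - by exists 0, 0; split=> [y _|y _|]; rewrite ?mul0r ?mulr0 ?addr0 //; apply: base0.
  - move=> _ _ [u [v [Iu Iv' ->]]] [u' [v' [Iu' Iv'' ->]]].
    by exists (u + u'), (v + v'); split; [apply: IvD|apply: IvD|ring].
  - move=> _ w [_ /IP[c [d ->]] <-] Iw; exists (c%:F * w), (d%:F * w).
    split; [by apply: IvM => //; exists c|by apply: IvM => //; exists d|].
    by rewrite tofracD !tofracM; ring.
have ea : emb I a%:F by exists a.
have es : emb I s%:F by exists s.
have [al _ eal] := Iu _ ea; have [be _ ebe] := Iu _ es.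
have [ga _ ega] := Iv' _ ea; have [de _ ede] := Iv' _ es.
have a0' : a%:F != 0 by rewrite tofrac_eq0.
have s0' := tofrac_neq0 s0.
have [Mal|nMal] := pselect (M al); last first.
  right; rewrite invf_div; exists be, al; split=> //.
  have al0 := maximal_ideal_notin0 mM nMal.
  rewrite eal in al0 *; rewrite ebe.
  have u0 : u != 0 by apply: contra_neq al0 => ->; rewrite mul0r.
  by rewrite -mulf_div divff ?mul1r.
left; exists ga, de.
have nMde : ~ M de.
  move=> Mde; apply: (maximal_ideal_proper mM).
  suff -> : 1 = al + de by apply: idealD => //; apply: maximal_ideal_ideal.
  apply/eqP; rewrite -tofrac_eq tofracD tofrac1 e eal ede; apply/eqP; ring.
split=> //.
have de0 := maximal_ideal_notin0 mM nMde.
rewrite ede in de0 *; rewrite ega.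
have v0 : v != 0 by apply: contra_neq de0 => ->; rewrite mul0r.
by rewrite -mulf_div divff ?mul1r.
Qed.

End BaseRing.

(** * Products of ideals *)

Section Products.
Variable R : idomainType.
Variables (T : Type) (M : T -> set R).
Hypothesis idM : forall i, ideal (M i).
Local Notation prod r P := (\big[@fmul _/base R]_(i <- r | P i) emb (M i)).

Lemma prod_base r (P : pred T) : prod r P `<=` base R.
Proof.
apply: (big_ind (fun F : set _ => F `<=` base R)) => // [F G FR GR|i _].
  apply: fmul_ind => [|x y|x y Fx Gy]; [exact: base0|exact: baseD|].
  by apply: baseM; [apply: FR|apply: GR].
exact: emb_base.
Qed.

Lemma prod_smul r (P : pred T) : smul_closed (base R) (prod r P).
Proof.
apply: (big_ind (fun F : set _ => smul_closed (base R) F)) => [|F G FR GR|i _].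
- exact: baseM.
- exact: fmul_smul.
- exact: emb_smul.
Qed.

Lemma prod0 r (P : pred T) : prod r P 0.
Proof.
apply: (big_ind (fun F : set {fraction R} => F 0)) => [|F G _ _|i _].
- exact: base0.
- exact: fmul0.
- by apply/emb0; apply: idM.
Qed.

Lemma prod_add r (P : pred T) x y : prod r P x -> prod r P y -> prod r P (x + y).
Proof.
pose addc (F : set {fraction R}) := forall x y : {fraction R}, F x -> F y -> F (x + y).
suff : addc (prod r P) by apply.
apply: (big_ind addc) => [x' y'|F G _ _ x' y'|i _ x' y'].
- exact: baseD.
- exact: fmul_add.
- exact: emb_add.
Qed.

Lemma prod_in r (P : pred T) (a : T -> R) : (forall i, P i -> M i (a i)) ->
  prod r P (\prod_(i <- r | P i) a i)%:F.
Proof.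
move=> Ma; apply: (big_ind2 (fun (F : set {fraction R}) x => F x%:F)).
- by rewrite tofrac1; apply: base1.
- by move=> F x G y Fx Gy; rewrite tofracM; apply: fmul_in.
- by move=> i Pi; exists (a i) => //; apply: Ma.
Qed.

Lemma prod_omit r (P : pred T) : prod r predT `<=` prod r P.
Proof.
elim: r => [|i r IHr]; first by rewrite !big_nil.
rewrite !big_cons; case: (P i) => /=.
  apply: fmul_ind => [|x y|x y Mx ry]; [exact: fmul0|exact: fmul_add|].
  by apply: fmul_in => //; apply: IHr.
apply: fmul_ind => [|x y|x y Mx ry]; [| exact: prod_add |].
  exact: prod0.
by apply: prod_smul; [apply: (emb_base Mx)|apply: IHr].
Qed.
End Products.

Lemma prod_sub_factor (R : idomainType) (T : eqType) (M : T -> set R) r k :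
  (forall i, ideal (M i)) -> k \in r ->
  \big[@fmul _/base R]_(i <- r) emb (M i) `<=` emb (M k).
Proof.
move=> idM; elim: r => // i r IHr; rewrite inE big_cons => /predU1P[->|kr].
  by apply: fmul_emb_sub => //; apply: prod_base.
apply: fmul_ind => [|x y|x y Mx ry].
- exact: emb0.
- exact: emb_add.
- by apply: emb_smul => //; [apply: (emb_base Mx)|apply: IHr].
Qed.

(** * Divisoriality and localization *)

Section LocalDivisoriality.
Variable R : idomainType.
Hypothesis hR : prufer R.
Implicit Types I M N : set R.

Lemma ext_divisorial_not_sub M I : maximal_ideal M -> ideal I ->
  ~ I `<=` M -> divisorial (loc M) (ext I M).
Proof.
move=> mM idI nIM.
have [a Ia nMa] : exists2 a, I a & ~ M a.
  apply: contrapT => nex; apply: nIM => a Ia.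
  by apply: contrapT => nMa; apply: nex; exists a.
apply/divisorialP => z /(_ 1); rewrite mulr1 => Vz.
have {}Vz : loc M z.
  apply: Vz => _ /(extP mM _ idI) [b [s [_ nMs ->]]]; rewrite mul1r.
  by exists b, s.
rewrite -[z]mulr1; apply: ext_smul => //; apply/extP => //; exists a, a.
by split=> //; rewrite divff // (maximal_ideal_notin0 mM).
Qed.

Lemma ext0 M I : maximal_ideal M -> ideal I -> ext I M 0.
Proof.
move=> mM idI; apply/extP => //; exists 0, 1.
rewrite tofrac0 mul0r; split=> //; [exact: ideal0|exact: maximal_ideal_proper].
Qed.

Lemma loc_nonunit M x : maximal_ideal M -> x = 0 \/ ~ loc M x^-1 ->
  exists a t, [/\ M a, ~ M t & x = a%:F / t%:F].
Proof.
move=> mM [->|nVx].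
  exists 0, 1; rewrite tofrac0 mul0r; split=> //.
    exact: (ideal0 (maximal_ideal_ideal mM)).
  exact: maximal_ideal_proper.
have [//|[a [t [nMt e]]]] : loc M x^-1 \/ loc M x.
  by have := valuation_total (prufer_valuation hR mM) x; tauto.
exists a, t; split=> //; apply: contrapT => nMa; apply: nVx.
by rewrite e invf_div; exists t, a.
Qed.

(** With I R_M = y m, every z in M^{-1} is in R: at N <> M because M meets the
    complement of N; at M because z / y multiplies y m into R_M, so that y in
    the divisorial closure gives z in R_M.  Hence M^{-1} = R and M^v = R. *)
Lemma nondivisorial_ext_maximal M I : maximal_ideal M -> ideal I ->
  ~ divisorial (loc M) (ext I M) -> ~ divisorial (base R) (emb M).
Proof.
move=> mM idI /not_divisorialP[y vy nJy] dM.
have idM := maximal_ideal_ideal mM.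
have vV := prufer_valuation hR mM.
suff finvM : finv (base R) (emb M) `<=` base R.
  apply: (maximal_ideal_proper mM); apply/embP; rewrite dM tofrac1.
  by move=> x /finvM; rewrite mul1r.
move=> z zM; apply: base_local => N mN.
have [eNM|neNM] := pselect (N = M); last first.
  have [s Ms nNs] := maximal_ideal_neq mN mM neNM.
  have /(base_loc mN) : base R (z * s%:F) by apply: zM; exists s.
  move=> /(loc_mul mN) /(_ (inv_loc nNs)).
  by rewrite mulfK // (maximal_ideal_notin0 mN).
rewrite {N mN}eNM.
have y0 : y != 0 by apply: contra_notN nJy => /eqP ->; apply: ext0.
have -> : z = y * (z / y) by rewrite mulrC divfK.
apply: (vy) => j /(valuation_nondivisorialE vV (ext_smul mM idI) (ext0 mM idI) vy nJy) jE.
have [a [t [Ma nMt e]]] : exists a t, [/\ M a, ~ M t & j / y = a%:F / t%:F].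
  apply: loc_nonunit => //; case: jE => [->|]; first by left; rewrite mul0r.
  by right; rewrite invf_div.
rewrite mulrAC -mulrA e mulrA; apply: loc_mul => //; last exact: inv_loc.
by apply/base_loc/zM => //; exists a.
Qed.

Lemma nonfactor_divisorial M I : maximal_ideal M -> ideal I ->
  ~ factor_set I M -> divisorial (loc M) (ext I M).
Proof.
move=> mM idI nf; apply: contrapT => nd.
have [IM|nIM] := pselect (I `<=` M); last exact/nd/ext_divisorial_not_sub.
by apply: nf; split=> //; apply: nondivisorial_ext_maximal nd.
Qed.

(** * Independence and h-locality *)

(** Elementwise form of R_M R_N = K for distinct maximal M and N; the equation
    says that 1 / q = r / (s t). *)
Definition independent_maximals := forall M N q,
  maximal_ideal M -> maximal_ideal N -> M <> N -> q <> 0 ->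
  exists s t r, [/\ ~ M s, ~ N t & s * t = q * r].

(** If q witnessed the failure of independence, the elements of R with no multiple
    of the form s t, s outside M and t outside N, would be a nonzero prime
    ideal inside both M and N: it is the contraction of the maximal ideal of
    R_M R_N.  Closure under addition is where R_M has to be a valuation ring. *)
Lemma h_local_independent : h_local R -> independent_maximals.
Proof.
move=> [_ hP] M N q mM mN neMN q0; apply: contrapT => nex.
pose P : set R := [set x | forall s t r, ~ M s -> ~ N t -> s * t <> x * r].
have idM := maximal_ideal_ideal mM; have idN := maximal_ideal_ideal mN.
have M1 := maximal_ideal_proper mM; have N1 := maximal_ideal_proper mN.
have Pq : P q by move=> s t r nMs nNt e; apply: nex; exists s, t, r.
have PM : P `<=` M.
  by move=> x Px; apply: contrapT => nMx; apply: (Px x 1 1).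
have PN : P `<=` N.
  by move=> x Px; apply: contrapT => nNx; apply: (Px 1 x 1) => //; rewrite mulrC.
have PMul a u : P u -> P (a * u).
  by move=> Pu s t r nMs nNt e; apply: (Pu s t (a * r)) => //; rewrite e; ring.
have P0 : P 0.
  move=> s t r nMs nNt; rewrite mul0r => /eqP; rewrite mulf_eq0 => /orP[] /eqP e.
    by apply: nMs; rewrite e; apply: ideal0.
  by apply: nNt; rewrite e; apply: ideal0.
have PAdd' u v a t : ~ M t -> P u -> v * t = u * a -> P (u + v).
  move=> nMt Pu e s' t' r nMs nNt e'; apply: (Pu (t * s') t' ((t + a) * r)) => //.
    exact: maximal_ideal_mul.
  by rewrite -mulrA e'; transitivity (u * t * r + v * t * r); [ring|rewrite e; ring].
have PD u v : P u -> P v -> P (u + v).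
  move=> Pu Pv; have [->|u0] := eqVneq u 0; first by rewrite add0r.
  have [->|v0] := eqVneq v 0; first by rewrite addr0.
  have frac_eq x y a t : x != 0 -> ~ M t -> y%:F / x%:F = a%:F / t%:F -> y * t = x * a.
    move=> x0 nMt /eqP; rewrite eqr_div ?tofrac_eq0 //; last first.
      by have := maximal_ideal_notin0 mM nMt; rewrite tofrac_eq0.
    by rewrite -!tofracM tofrac_eq => /eqP ->; rewrite mulrC.
  have [|] := valuation_total (prufer_valuation hR mM) (v%:F / u%:F).
    by move=> [a [t [nMt /(frac_eq _ _ _ _ u0 nMt) e]]]; apply: PAdd' nMt Pu e.
  rewrite invf_div => -[a [t [nMt /(frac_eq _ _ _ _ v0 nMt) e]]].
  by rewrite addrC; apply: PAdd' nMt Pv e.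
have primeP : prime_ideal P.
  split.
    apply/proper_idealP; split; last by move/PM.
    by apply/idealP; split=> // a u v Pu Pv; apply: PD => //; apply: PMul.
  move=> u v /set_mem Puv; apply/orP; apply: contrapT => nP.
  have nin x : ~ P x -> exists s t r, [/\ ~ M s, ~ N t & s * t = x * r].
    move=> nPx; apply: contrapT => nex'; apply: nPx => s t r nMs nNt e.
    by apply: nex'; exists s, t, r.
  have [s [t [r [nMs nNt e]]]] := nin u (fun Pu => nP (or_introl (mem_set Pu))).
  have [s' [t' [r' [nMs' nNt' e']]]] := nin v (fun Pu => nP (or_intror (mem_set Pu))).
  apply: (Puv (s * s') (t * t') (r * r')); [exact: maximal_ideal_mul..|].
  by transitivity ((s * t) * (s' * t')); [ring|rewrite e e'; ring].
have [|L [_ uniqL]] := hP P primeP.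
  by move=> P0'; move: Pq; rewrite P0'.
by apply: neMN; rewrite -(uniqL M) // -(uniqL N).
Qed.

(** The factor s makes s z integral at finitely many maximal ideals other than M
    while staying a unit at M. *)
Lemma common_denominator M z (L : seq (set R)) :
  independent_maximals -> maximal_ideal M ->
  exists2 s, ~ M s & forall N, N \in L -> maximal_ideal N -> N <> M ->
    loc N (s%:F * z).
Proof.
move=> ind mM; elim: L => [|N L [s nMs sL]].
  by exists 1 => //; apply: maximal_ideal_proper.
have [p [q [q0 ez]]] := fractionP z.
have [[mN neNM]|nN] := pselect (maximal_ideal N /\ N <> M); last first.
  by exists s => // N'; rewrite inE => /predU1P[->|/sL//] mN neNM; case: nN.
have [s' [t [r [nMs' nNt e]]]] := ind M N q mM mN (nesym neNM) q0.
exists (s' * s); first exact: maximal_ideal_mul.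
move=> N'; rewrite inE => /predU1P[->|N'L] mN' neN'; last first.
  rewrite tofracM -mulrA; apply: loc_mul => //; last exact: sL.
  exact: tofrac_loc.
have q0' := tofrac_neq0 q0; have t0' := maximal_ideal_notin0 mN nNt.
have es : s'%:F = q%:F * r%:F / t%:F by rewrite -!tofracM -e tofracM mulfK.
exists (r * s * p), t; split=> //; rewrite tofracM es ez !tofracM.
have cancel (K : fieldType) (a b c d f : K) : a != 0 ->
    a * b / c * d * (f / a) = b * d * f / c.
  by move=> a0; rewrite -[RHS](mulfK a0); ring.
exact: cancel.
Qed.

(** The inverse (R : F) localizes to (R_M : F R_M), for any F with a common
    denominator d.  Only the finitely many maximal ideals that contain the
    denominator q of z / d obstruct z F from lying in R, and independence
    clears them one at a time. *)
Lemma local_inverse M z F d : finite_character R -> independent_maximals ->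
  maximal_ideal M -> d != 0 -> (forall f, F f -> base R (d * f)) ->
  (forall f, F f -> loc M (z * f)) ->
  exists2 s, ~ M s & finv (base R) F (s%:F * z).
Proof.
move=> fc ind mM d0 Fd Fz.
have [p [q [q0 ez]]] := fractionP (z / d).
have /finite_seqP[L eL] := fc q q0.
have [s nMs sL] := common_denominator (z / d) L ind mM.
exists s => // f Ff; apply: base_local => N mN.
have [->|neNM] := pselect (N = M).
  by rewrite -mulrA; apply: loc_mul => //; [apply: tofrac_loc|apply: Fz].
have -> : s%:F * z * f = s%:F * (z / d) * (d * f).
  by rewrite -!mulrA (mulrA d^-1) mulVf // mul1r.
apply: loc_mul => //; last by apply/base_loc/Fd.
have [Nq|nNq] := pselect (N q).
  apply: sL => //; have : [set` L] N by rewrite -eL.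
  by [].
by apply: loc_mul => //; [apply: tofrac_loc|exists p, q].
Qed.

Section HLocal.
Hypotheses (fc : finite_character R) (ind : independent_maximals).
Variables (I : set R).
Hypothesis hI : nonzero_ideal I.

Lemma nonzero_idealP : exists2 a, I a & a <> 0.
Proof.
case: hI => idI I0; apply: contrapT => nex; apply: I0.
apply/seteqP; split=> a; last by move=> ->; apply: ideal0.
by move=> Ia; apply: contrapT => a0; apply: nex; exists a.
Qed.

Lemma vclosure_ext M z : maximal_ideal M -> vclosure (base R) (emb I) z ->
  vclosure (loc M) (ext I M) z.
Proof.
move=> mM vz w wJ.
have [s nMs sw] : exists2 s, ~ M s & finv (base R) (emb I) (s%:F * w).
  apply: (@local_inverse M w (emb I) 1) => //.
  - exact: oner_neq0.
  - by move=> f /emb_base; rewrite mul1r.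
  - move=> _ [a Ia <-]; apply: wJ; apply/extP => //; first by case: hI.
    exists a, 1; rewrite tofrac1 divr1; split=> //.
    exact: maximal_ideal_proper.
have := loc_mul mM (inv_loc nMs) (base_loc mM (vz _ sw)).
by rewrite mulrCA mulKf // (maximal_ideal_notin0 mM).
Qed.

Lemma ext_vclosure M z : maximal_ideal M -> vclosure (loc M) (ext I M) z ->
  exists2 s, ~ M s & vclosure (base R) (emb I) (s%:F * z).
Proof.
move=> mM vz; have [a Ia a0] := nonzero_idealP; have [idI _] := hI.
apply: (@local_inverse M z (finv (base R) (emb I)) a%:F) => //.
- exact: tofrac_neq0.
- by move=> f fI; rewrite mulrC; apply: fI; exists a.
- by move=> f /(finv_emb_ext mM idI); apply: vz.
Qed.
End HLocal.
End LocalDivisoriality.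

(** * Strong factorization of h-local domains *)

Section StrongFactorization.
Variable R : idomainType.
Hypothesis hR : prufer R.
Implicit Types I M N : set R.

Lemma factor_set_finite I : finite_character R -> nonzero_ideal I ->
  finite_set (factor_set I).
Proof.
move=> fc /nonzero_idealP[a Ia /fc]; apply: sub_finite_set.
by move=> M [mM _ IM _]; split=> //; apply: IM.
Qed.

Lemma finite_enumeration (T : eqType) (A : set T) : finite_set A ->
  exists n (f : 'I_n -> T), injective f /\ A = range f.
Proof.
move=> /finite_seqP[r ->]; exists (size (undup r)), (tnth (in_tuple (undup r))).
split; first by apply/tuple_uniqP; apply: undup_uniq.
apply/seteqP; split=> x /=; rewrite -mem_undup.
  by move=> /(tnthP (in_tuple (undup r)))[i ->]; exists i.
by move=> [i _ <-]; apply: mem_tnth.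
Qed.

Lemma nonzero_ideal_ideal I : nonzero_ideal I -> ideal I. Proof. by case. Qed.

(** Away from the maximal ideals M i their product contains a unit of R_N. *)
Lemma avoid_factors n (M : 'I_n -> set R) (P : pred 'I_n) N : maximal_ideal N ->
  (forall i, maximal_ideal (M i)) -> (forall i, P i -> M i <> N) ->
  exists2 s, ~ N s & (\big[@fmul _/base R]_(i < n | P i) emb (M i)) s%:F.
Proof.
move=> mN mM neMN.
have /choice[a aP] i : exists s, P i -> M i s /\ ~ N s.
  have [Pi|nPi] := boolP (P i); last by exists 0.
  have [s Ms nNs] := maximal_ideal_neq mN (mM i) (nesym (neMN i Pi)).
  by exists s.
exists (\prod_(i < n | P i) a i); last by apply: prod_in => i /aP[].
apply: (big_ind (fun x => ~ N x)) => [|x y|i /aP[]//].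
  exact: maximal_ideal_proper.
exact: maximal_ideal_mul.
Qed.

(** At M k the other factors are invisible: the product contains each element of
    M k up to a unit of the localization. *)
Lemma avoid_factors_but_one n (M : 'I_n -> set R) k b : injective M ->
  (forall i, maximal_ideal (M i)) -> M k b ->
  exists2 s, ~ M k s & (\big[@fmul _/base R]_(i < n) emb (M i)) (b * s)%:F.
Proof.
move=> injM mM Mb.
have /choice[a aP] i : exists s, i != k -> M i s /\ ~ M k s.
  have [->|neik] := eqVneq i k; first by exists 0.
  have [|s Ms nMs] := maximal_ideal_neq (mM k) (mM i); last by exists s.
  by move=> /injM /esym/eqP; apply/negP.
exists (\prod_(i < n | i != k) a i).
  apply: (big_ind (fun x => ~ M k x)) => [|x y|i /aP[]//].
    exact: maximal_ideal_proper.
  exact: maximal_ideal_mul.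
have -> : b * (\prod_(i < n | i != k) a i) =
    \prod_(i < n) (if i == k then b else a i).
  rewrite [RHS](bigD1 k) //= eqxx; congr (_ * _).
  by apply: eq_bigr => i /negPf ->.
by apply: prod_in => i _; case: eqVneq => [->//|/aP[]].
Qed.

Lemma h_local_strong_factorization : h_local R -> strong_factorization R.
Proof.
move=> hloc I hI; have [fc _] := hloc.
have ind := h_local_independent hR hloc; have idI := nonzero_ideal_ideal hI.
have [n [M [injM facE]]] := finite_enumeration (factor_set_finite fc hI).
have facM i : factor_set I (M i) by rewrite facE; exists i.
have mM i : maximal_ideal (M i) by have [] := facM i.
have idM i := maximal_ideal_ideal (mM i).
have vV N (mN : maximal_ideal N) := prufer_valuation hR mN.
pose Iv := vclosure (base R) (emb I).
have IvM : smul_closed (base R) Iv.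
  by move=> a u Ra Iu f fI; rewrite -mulrA; apply: baseM => //; apply: Iu.
have neM N i : ~ factor_set I N -> M i <> N by move=> nf e; apply: nf; rewrite -e.
pose D (P : pred 'I_n) := \big[@fmul _/base R]_(i < n | P i) emb (M i).
have loc_nondiv k : exists y s, [/\ ~ ext I (M k) y, ~ M k s, Iv (s%:F * y),
    forall z, ext I (M k) z <-> z = 0 \/ ~ loc (M k) (y / z) &
    forall z, vclosure (loc (M k)) (ext I (M k)) z <-> loc (M k) (z / y)].
  have [_ _ _ /not_divisorialP[y vy nJy]] := facM k.
  have [s nMs vs] := ext_vclosure fc ind hI (mM k) vy.
  exists y, s; split=> //.
    exact: valuation_nondivisorialE (vV _ (mM k)) (ext_smul (mM k) idI) (ext0 _ _) vy nJy.
  exact: valuation_nondivisorial_vclosureE (vV _ (mM k)) (ext_smul (mM k) idI) (ext0 _ _) vy nJy.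
exists n, M; split=> //.
  apply/seteqP; split=> x Ix.
    apply: local_to_global => [|||N mN].
    - exact: fmul0.
    - exact: fmul_add.
    - exact: fmul_smul.
    have [Nf|nNf] := pselect (factor_set I N); last first.
      have [s nNs Ds] := @avoid_factors n M predT N mN mM (fun i _ => neM N i nNf).
      by exists s => //; rewrite mulrC; apply: fmul_in => //; apply: subset_vclosure.
    have [k _ eN] : range M N by rewrite -facE.
    subst N; have [y [s [nJy nMs vs JE vE]]] := loc_nondiv k.
    have [a Ia ex] := Ix.
    have Jx : ext I (M k) x.
      apply/extP => //; exists a, 1; rewrite tofrac1 divr1; split=> //.
      exact: maximal_ideal_proper.
    have y0 : y != 0 by apply: contra_notN nJy => /eqP ->; apply: ext0.
    have [b [t [Mb nMt e]]] : exists b t, [/\ M k b, ~ M k t & x / y = b%:F / t%:F].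
      apply: loc_nonunit => //; have /JE[->|] := Jx; first by left; rewrite mul0r.
      by right; rewrite invf_div.
    have [s' nMs' Ds'] := avoid_factors_but_one injM mM Mb.
    exists (s * t * s'); first by do 2?[apply: maximal_ideal_mul => //].
    have t0 := maximal_ideal_notin0 mN nMt.
    have -> : (s * t * s')%:F * x = s%:F * y * (b * s')%:F.
      rewrite -[x](divfK y0) e !tofracM -[in RHS](divfK t0 b%:F); ring.
    exact: fmul_in.
  apply: emb_local => // N mN.
  move: x Ix; apply: fmul_ind => [|x z|f g If Dg]; [exact: ext0|exact: fmul_add|].
  have vf := vclosure_ext fc ind hI mN If.
  have [Nf|nNf] := pselect (factor_set I N); last first.
    rewrite mulrC; apply: ext_smul => //; first by apply/base_loc/(prod_base Dg).
    by rewrite (nonfactor_divisorial hR mN idI nNf).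
  have [k _ eN] : range M N by rewrite -facE.
  subst N; have [y [s [nJy nMs vs JE vE]]] := loc_nondiv k.
  have [c Mc eg] : emb (M k) g by apply: prod_sub_factor Dg; rewrite ?mem_index_enum.
  apply/JE; have [fg0|fg0] := eqVneq (f * g) 0; [by left|right=> Vfg].
  have := loc_mul mN ((vE f).1 vf) Vfg.
  move: fg0; rewrite mulf_eq0 negb_or => /andP[f0 g0].
  have y0 : y != 0 by apply: contra_notN nJy => /eqP ->; apply: ext0.
  have -> : f / y * (y / (f * g)) = g^-1.
    by rewrite mulrA divfK // invfM mulrA divff // mul1r.
  rewrite -eg; move/inv_loc_notin; apply=> //.
  by move=> c0; rewrite -eg c0 tofrac0 eqxx in g0.
move=> k e.
have [y [s [nJy nMs vs JE vE]]] := loc_nondiv k.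
have [t nMt Dt] := @avoid_factors n M (fun i => i != k) (M k) (mM k) mM
  (fun i neik eM => elimN eqP neik (injM _ _ eM)).
have : emb I (s%:F * y * t%:F) by rewrite e; apply: fmul_in.
move=> [a Ia ea]; apply: nJy; apply/extP => //; exists a, (s * t).
split=> //; first exact: maximal_ideal_mul.
have s0 := maximal_ideal_notin0 (mM k) nMs.
have t0 := maximal_ideal_notin0 (mM k) nMt.
by rewrite ea tofracM [s%:F * y * _]mulrAC [RHS]mulrAC divff ?mulf_neq0 // mul1r.
Qed.
End StrongFactorization.

(** * Local criteria for divisoriality *)

Section ConverseDirections.
Variable R : idomainType.
Hypothesis hR : prufer R.
Implicit Types I M N : set R.

(** Here the omission clause does the work: when I = I^v, the product without
    the k-th factor still lies between I and I^v. *)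
Lemma strong_factorization_divisorial I : strong_factorization R ->
  nonzero_ideal I -> divisorial (base R) (emb I) <->
  forall M, maximal_ideal M -> divisorial (loc M) (ext I M).
Proof.
move=> sf hI; have idI := nonzero_ideal_ideal hI.
have [n [M [injM facE IE Iomit]]] := sf I hI; split=> [dI N mN|dIM].
  apply: nonfactor_divisorial => // Nf.
  have [k _ eN] : range M N by rewrite -facE.
  have idM i : ideal (M i).
    have [mM _ _ _] : factor_set I (M i) by rewrite facE; exists i.
    exact: maximal_ideal_ideal.
  apply: (Iomit k); apply/seteqP; split=> x.
    rewrite {1}IE; apply: fmul_ind => [|y z|y z Iy Dz]; [exact: fmul0|exact: fmul_add|].
    by apply: fmul_in => //; apply: prod_omit Dz.
  rewrite -dI; apply: fmul_emb_sub => //; exact: prod_base.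
have n0 : n = 0%N.
  case: n M injM facE IE Iomit => // n M injM facE _ _.
  have [mM _ _ []] : factor_set I (M ord0) by rewrite facE; exists ord0.
  exact: dIM.
subst n; apply/divisorialP => x Ix.
by rewrite IE big_ord0 -[x]mulr1; apply: fmul_in => //; apply: base1.
Qed.

Hypothesis local_divisorial : forall I, nonzero_ideal I ->
  (forall M, maximal_ideal M -> divisorial (loc M) (ext I M)) ->
  divisorial (base R) (emb I).

(** The ideal of R that is x R_N at N, and as large as this allows elsewhere. *)
Definition contraction (N : set R) (x : R) : set R :=
  [set r | loc N (r%:F / x%:F)].

Lemma loc_add N u v : maximal_ideal N -> loc N u -> loc N v -> loc N (u + v).
Proof.
move=> mN [a [s [nNs ->]]] [b [t [nNt ->]]].
exists (a * t + b * s), (s * t); split; first exact: maximal_ideal_mul.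
by rewrite addf_div ?(maximal_ideal_notin0 mN) // tofracD !tofracM.
Qed.

Lemma contraction_nonzero N x : maximal_ideal N -> x <> 0 ->
  nonzero_ideal (contraction N x).
Proof.
move=> mN x0; split.
  apply/idealP; rewrite /contraction; split=> /= [|a u v Lu Lv].
    by rewrite tofrac0 mul0r -tofrac0; apply: tofrac_loc.
  rewrite tofracD tofracM mulrDl -mulrA; apply: loc_add => //.
  by apply: loc_mul => //; apply: tofrac_loc.
move=> e; have : contraction N x x.
  by rewrite /contraction /= divff ?tofrac_neq0 // -tofrac1; apply: tofrac_loc.
by rewrite e.
Qed.

(** Clearing the denominators of R_M turns an element of R_M \cap x R_M R_N into
    one of R \cap x R_N. *)
Lemma ext_contraction M N x z : maximal_ideal M -> maximal_ideal N -> x <> 0 ->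
  ext (contraction N x) M z <-> loc M z /\ compositum (loc M) (loc N) (z / x%:F).
Proof.
move=> mM mN x0; have [idI _] := contraction_nonzero mN x0.
have x0' := tofrac_neq0 x0.
split=> [/(extP mM _ idI)[a [s [Ia nMs ->]]]|[Mz [v [w [Mv Nw ez]]]]].
  split; first by exists a, s.
  exists s%:F^-1, (a%:F / x%:F); split=> //; first exact: inv_loc.
  by ring.
case: Mv ez => [a [s [nMs ->]]] ez; case: Mz => [b [t [nMt ez']]].
have s0 := maximal_ideal_notin0 mM nMs; have t0 := maximal_ideal_notin0 mM nMt.
apply/extP => //; exists (b * s), (t * s); split.
- rewrite /contraction /=.
  have eb : b%:F = z * t%:F by rewrite ez' divfK.
  have ea : z / x%:F * s%:F = a%:F * w by rewrite ez mulrAC divfK.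
  have -> : (b * s)%:F / x%:F = (a * t)%:F * w.
    transitivity (z / x%:F * s%:F * t%:F); first by rewrite tofracM eb; ring.
    by rewrite ea tofracM; ring.
  by apply: loc_mul => //; apply: tofrac_loc.
- exact: maximal_ideal_mul.
- by rewrite ez' !tofracM -mulf_div divff // mulr1.
Qed.

(** Locally, J = R_M \cap x T with T = R_M R_N.  Suppose y is in J^v but not in J.
    If T = R_M then 1 / x is in J^{-1} and y is in x T.  Otherwise pick c in T
    outside R_M: y / c is in J by the description of nondivisorial modules,
    and multiplying by c puts y in x T again. *)
Lemma contraction_divisorial N x : maximal_ideal N -> x <> 0 ->
  divisorial (base R) (emb (contraction N x)).
Proof.
move=> mN x0; have hI := contraction_nonzero mN x0.
apply: local_divisorial => // M mM; apply/divisorialP => y vy.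
have vV := prufer_valuation hR mM; have vW := prufer_valuation hR mN.
pose T := compositum (loc M) (loc N).
have vT : valuation T := compositum_valuation vV vW.
have VT : loc M `<=` T by apply: compositum_left; apply: valuation1.
have x0' := tofrac_neq0 x0.
have My : loc M y.
  rewrite -[y]mulr1; apply: vy => j /ext_contraction[] // Mj _.
  by rewrite mul1r.
apply/ext_contraction => //; split=> //; apply: contrapT => nTy.
have [TV|nTV] := pselect (T `<=` loc M).
  apply/nTy/VT/vy => j /(ext_contraction _ mM mN x0)[_ Tj].
  by rewrite mulrC; apply: TV.
have [c Tc nVc] : exists2 c, T c & ~ loc M c.
  apply: contrapT => nex; apply: nTV => c Tc.
  by apply: contrapT => nVc; apply: nex; exists c.
have c0 : c != 0 by apply: contra_notN nVc => /eqP ->; apply: valuation0.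
have y0 : y != 0.
  by apply: contra_notN nTy => /eqP ->; rewrite mul0r; apply: valuation0.
have [idI _] := hI.
have nJy : ~ ext (contraction N x) M y by move=> /(ext_contraction _ mM mN x0)[].
have /(ext_contraction _ mM mN x0)[_ Tycx] : ext (contraction N x) M (y / c).
  apply/(valuation_nondivisorialE vV (ext_smul mM idI) (ext0 mM idI) vy nJy).
  by right; rewrite invf_div mulrC divfK.
apply: nTy; have := valuationM vT Tc Tycx.
by rewrite mulrA [c * _]mulrC divfK.
Qed.

(** A nonzero x with 1 / x outside T = R_M R_N yields r = t x / s, with s in N but
    not in M, in the divisorial closure of R \cap x R_N but not in x R_N. *)
Lemma independent_of_local_divisorial : independent_maximals R.
Proof.
move=> M N x mM mN neMN x0; apply: contrapT => nex.
have vV := prufer_valuation hR mM; have vW := prufer_valuation hR mN.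
pose T := compositum (loc M) (loc N).
have vT : valuation T := compositum_valuation vV vW.
have VT : loc M `<=` T by apply: compositum_left; apply: valuation1.
have WT : loc N `<=` T by apply: compositum_right; apply: valuation1.
have x0' := tofrac_neq0 x0.
have nTx : ~ T x%:F^-1.
  move=> [_ [_ [[a [s [nMs ->]]] [b [t [nNt ->]]] e]]]; apply: nex.
  exists s, t, (a * b); split=> //; apply/eqP; rewrite -tofrac_eq !tofracM; apply/eqP.
  have s0 := maximal_ideal_notin0 mM nMs; have t0 := maximal_ideal_notin0 mN nNt.
  move: e; set u := a%:F / s%:F; set v := b%:F / t%:F => e.
  have -> : a%:F = u * s%:F by rewrite divfK.
  have -> : b%:F = v * t%:F by rewrite divfK.
  by rewrite mulrACA -e mulVKf.
have [s Ns nMs] := maximal_ideal_neq mM mN neMN.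
have s0 := maximal_ideal_notin0 mM nMs.
have Tsi : T s%:F^-1 by apply/VT/inv_loc.
have [r [t [nNt e]]] : loc N (x%:F / s%:F).
  have [//|] := valuation_total vW (x%:F / s%:F); rewrite invf_div => /WT Tsx.
  case: nTx; have := valuationM vT Tsi Tsx; by rewrite mulKf.
have t0 := maximal_ideal_notin0 mN nNt.
have er : r%:F / x%:F = t%:F / s%:F.
  have -> : r%:F = x%:F / s%:F * t%:F by rewrite e divfK.
  by rewrite mulrAC [_ / x%:F]mulrAC divff // mul1r mulrC.
have r0 : r%:F != 0.
  apply/eqP => r0; move/esym/eqP: er; rewrite r0 mul0r mulf_eq0 invr_eq0.
  by rewrite (negPf t0) (negPf s0).
have /embP : emb (contraction N x) r%:F.
  rewrite (contraction_divisorial mN x0) => z zI; apply: base_local => L mL.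
  have [idI _] := contraction_nonzero mN x0.
  have zext K u (mK : maximal_ideal K) : loc K u ->
      compositum (loc K) (loc N) (u / x%:F) -> loc K (z * u).
    by move=> Ku Tu; apply: (finv_emb_ext mK idI zI); apply/ext_contraction.
  have [->|z0] := eqVneq z 0.
    by rewrite mulr0; apply: valuation0; apply: prufer_valuation.
  (* z x is in the maximal ideal of T: otherwise z x T = T would lie in R_M,
     making elements of M outside N invertible in R_M. *)
  have nTzx : ~ T (z * x%:F)^-1.
    move=> Tzx; have [m Mm nNm] := maximal_ideal_neq mN mM (nesym neMN).
    have Tm : T m%:F^-1 by apply/WT/inv_loc.
    have m0 : m <> 0.
      move=> m0; apply: nNm; rewrite m0; apply: ideal0.
      exact: maximal_ideal_ideal.
    apply: (inv_loc_notin mM _ m0 Mm).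
    pose u := (z * x%:F)^-1 * m%:F^-1.
    have Tu : T u by apply: valuationM.
    have {}m0 := tofrac_neq0 m0.
    have u0 : u != 0 by rewrite mulf_neq0 ?invr_neq0 // mulf_neq0.
    have -> : m%:F^-1 = z * (x%:F * u) by rewrite mulrA mulVKf // mulf_neq0.
    apply: zext => //; last by rewrite mulrC mulKf.
    apply: (nonunit_overring vV VT) => Txu; apply: nTx.
    have -> : x%:F^-1 = u * (x%:F * u)^-1 by rewrite invfM mulrCA divff // mulr1.
    exact: valuationM.
  rewrite mulrC.
  (* Both T and R_L R_N are R_N-modules, hence comparable. If T is the smaller,
     r lies in the localization at L of the contraction; if it is the larger,
     z r is in its maximal ideal, which is contained in R_L. *)
  have [TT'|T'T] := valuation_chain vW (compositum_smul_right (V := loc M) vW)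
     (compositum_smul_right (V := loc L) vW).
    apply: zext => //; first exact: tofrac_loc.
    by rewrite er; apply: TT'; apply: valuationM => //; apply: VT; apply: tofrac_loc.
  apply: (@nonunit_overring _ _ T _ (prufer_valuation hR mL)).
    by apply: subset_trans T'T; apply: compositum_left; apply: valuation1 vW.
  move=> Tzr; apply: nTzx.
  have -> : (z * x%:F)^-1 = (z * r%:F)^-1 * (r%:F / x%:F).
    by rewrite !invfM -!mulrA mulKf.
  by rewrite er; apply: valuationM => //; apply: valuationM => //; apply/WT/tofrac_loc.
rewrite /contraction /= er => Wts.
have /inv_loc_notin : loc N s%:F^-1.
  by have := loc_mul mN (inv_loc nNt) Wts; rewrite mulKf.
apply=> //; by move=> e0; rewrite e0 tofrac0 eqxx in s0.
Qed.

(** The ideal B collects the b that cancel the denominator x at all but finitely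
    many of the maximal ideals containing x. *)
Lemma finite_character_of_local_divisorial :
  independent_maximals R -> finite_character R.
Proof.
move=> ind x x0; have x0' := tofrac_neq0 x0.
pose X := [set M : set R | maximal_ideal M /\ M x].
pose B : set R := [set b | exists2 A : set (set R), finite_set A &
  forall M, X M -> ~ A M -> loc M (b%:F / x%:F)].
suff [A finA BA] : B 1.
  apply: sub_finite_set finA => M XM; apply: contrapT => nAM.
  have := BA M XM nAM; rewrite tofrac1 mul1r => /inv_loc_notin; apply => //; by case: XM.
have idB : ideal B.
  apply/idealP; split.
    exists set0 => // M [mM _] _; rewrite tofrac0 mul0r -tofrac0.
    exact: tofrac_loc.
  move=> a u v [A finA uA] [A' finA' vA]; exists (A `|` A').
    by rewrite finite_setU.
  move=> M XM nAM; have [mM _] := XM; rewrite tofracD tofracM mulrDl -mulrA.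
  apply: loc_add => //.
    by apply: loc_mul => //; [apply: tofrac_loc|apply: uA => // AM; apply: nAM; left].
  by apply: vA => // AM; apply: nAM; right.
apply: contrapT => nB1; have [M mM BM] := exists_maximal_ideal idB nB1.
have Mx : M x.
  apply: BM; exists set0 => // N [mN _] _.
  by rewrite divff // -tofrac1; apply: tofrac_loc.
(* Such a t is in B, with M as the only exception. *)
have nsep t : (forall N, maximal_ideal N -> N <> M -> loc N (t%:F / x%:F)) -> M t.
  by move=> Nt; apply: BM; exists [set M] => // N [mN _] neNM; apply: Nt.
have vV := prufer_valuation hR mM.
have xx0 : x * x <> 0 by apply/eqP; rewrite mulf_neq0; apply/eqP.
(* The square makes x a nonmember of the contraction, as x is in M. *)
have /embP : emb (contraction M (x * x)) x%:F.
  rewrite (contraction_divisorial mM xx0) => z zI.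
  have zN N : maximal_ideal N -> N <> M -> loc N z.
    move=> mN neNM.
    have [s [t [r [nMs nNt e]]]] := ind M N (x * x) mM mN (nesym neNM) xx0.
    have s0 := maximal_ideal_notin0 mM nMs; have t0 := maximal_ideal_notin0 mN nNt.
    have It : contraction M (x * x) t.
      exists r, s; split=> //; apply/eqP; rewrite eqr_div // ?tofrac_neq0 //.
      by rewrite -!tofracM tofrac_eq mulrC e mulrC.
    have := loc_mul mN (base_loc mN (zI _ (ex_intro2 _ _ t It erefl))) (inv_loc nNt).
    by rewrite mulfK.
  apply: base_local => N mN.
  have [->|neNM] := pselect (N = M); last first.
    by rewrite mulrC; apply: loc_mul => //; [apply: zN|apply: tofrac_loc].
  have [->|xz0] := eqVneq (x%:F * z) 0; first exact: valuation0.
  have [//|] := valuation_total vV (x%:F * z).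
  move=> [a [s [nMs e]]]; case: (nMs); apply: nsep => L mL neLM.
  have s0 := maximal_ideal_notin0 mM nMs.
  have -> : s%:F / x%:F = a%:F * z.
    have z0 : z != 0 by apply: contra_neq xz0 => ->; rewrite mulr0.
    have -> : a%:F = (x%:F * z)^-1 * s%:F by rewrite e divfK.
    by rewrite invfM [RHS]mulrAC divfK // mulrC.
  by apply: loc_mul => //; [apply: tofrac_loc|apply: zN].
rewrite /contraction /= tofracM invfM mulVKf // => /inv_loc_notin; exact.
Qed.

Lemma h_local_of_local_divisorial : h_local R.
Proof.
have ind := independent_of_local_divisorial.
split; first exact: finite_character_of_local_divisorial.
move=> P [/proper_idealP[idP nP1] primeP] P0.
have [M mM PM] := exists_maximal_ideal idP nP1.
exists M; split=> // N [mN PN]; apply: contrapT => neMN.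
have [q Pq q0] : exists2 q, P q & q <> 0 by apply: nonzero_idealP.
have [s [t [r [nMs nNt e]]]] := ind M N q mM mN neMN q0.
have : s * t \in mem P.
  by apply/mem_set; rewrite e mulrC; apply: idealM.
by move=> /primeP/orP[]/set_mem; [move/PM|move/PN].
Qed.

End ConverseDirections.

Theorem theorem1p12 (R : idomainType) (hR : prufer R) :
  [<-> h_local R;
       strong_factorization R;
       forall I : set R, nonzero_ideal I ->
         (divisorial (base R) (emb I) <->
          forall M : set R, maximal_ideal M -> divisorial (loc M) (ext I M));
       forall I : set R, nonzero_ideal I ->
         (forall M : set R, maximal_ideal M -> divisorial (loc M) (ext I M)) ->
         divisorial (base R) (emb I)].
Proof.
split; first exact: h_local_strong_factorization.
split; first by move=> sf I hI; apply: strong_factorization_divisorial.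
split; first by move=> h I hI; apply (h I hI).
exact: h_local_of_local_divisorial.
Qed.
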